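(* Let $G$ be a connected graph with $n$ vertices and let $p$ be a positive real number. Then $$A_p(G)\leq \left[Z_p(L(G))\right]^{\frac{1}{p}},$$ with equality if and only if $G\cong K_{1,\,n-1}$.
   Context: Graphs are finite, simple and undirected; $d(v)$ is the degree of vertex $v$ in the graph under consideration. For a positive real number $p$, the general Albertson irregularity index of a connected graph $G$ is $A_p(G)=\left(\sum_{uv\in E(G)}|d(u)-d(v)|^p\right)^{1/p}$. The first general Zagreb index of a graph $H$ is $Z_p(H)=\sum_{v\in V(H)}d^p(v)$, with degrees taken in $H$. The line graph $L(G)$ has the edges of $G$ as its vertices, two of them being adjacent if the corresponding edges of $G$ share a common vertex. $K_{1,\,n-1}$ is the star with $n$ vertices. *)

(* Defs.v *)
From HB Require Import structures.
From mathcomp Require Import all_boot all_order all_algebra.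
From mathcomp Require Import reals exp.

Set Implicit Arguments.
Unset Strict Implicit.
Unset Printing Implicit Defensive.

Import Order.TTheory GRing.Theory Num.Theory.
Local Open Scope ring_scope.

Record sgraph := SGraph {
  vertex :> finType;
  adj : rel vertex;
  adj_sym : symmetric adj;
  adj_irr : irreflexive adj
}.

Definition deg (G : sgraph) (v : G) : nat := #|[set w : G | adj v w]|.

(* The empty graph is not connected. *)
Definition graph_connected (G : sgraph) : Prop :=
  (0 < #|G|)%N /\ forall u v : G, connect (@adj G) u v.

Definition graph_iso (G H : sgraph) : Prop :=
  exists2 f : G -> H, bijective f & forall u v : G, adj (f u) (f v) = adj u v.

Definition edges (G : sgraph) : {set {set G}} :=
  [set [set uv.1; uv.2] | uv : G * G & adj uv.1 uv.2].

Section LineGraph.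
Variable G : sgraph.

Definition line_adj : rel {e : {set G} | e \in edges G} :=
  fun e f => (e != f) && (val e :&: val f != set0).

Lemma line_adj_sym : symmetric line_adj.
Proof. by move=> e f; rewrite /line_adj eq_sym setIC. Qed.

Lemma line_adj_irr : irreflexive line_adj.
Proof. by move=> e; rewrite /line_adj eqxx. Qed.

Definition line_graph : sgraph := SGraph line_adj_sym line_adj_irr.

End LineGraph.

Section CompleteBipartite.
Variables a b : nat.

Definition bip_adj : rel ('I_a + 'I_b)%type :=
  fun x y => match x, y with
             | inl _, inr _ | inr _, inl _ => true
             | _, _ => false
             end.

Lemma bip_adj_sym : symmetric bip_adj.
Proof. by move=> [x|x] [y|y]. Qed.

Lemma bip_adj_irr : irreflexive bip_adj.
Proof. by move=> [x|x]. Qed.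

Definition complete_bipartite : sgraph := SGraph bip_adj_sym bip_adj_irr.

End CompleteBipartite.

(* [edge_val f e] is [f u v] for an arbitrary choice of u, v with e = {u, v};
   by [edge_valE] the choice is immaterial when f is symmetric. *)
Definition edge_val (R : realType) (G : sgraph) (f : G -> G -> R)
    (e : {set G}) : R :=
  if [pick uv : G * G | e == [set uv.1; uv.2]] is Some uv
  then f uv.1 uv.2 else 0.

Lemma edge_valE (R : realType) (G : sgraph) (f : G -> G -> R) (u v : G) :
  (forall x y, f x y = f y x) -> edge_val f [set u; v] = f u v.
Proof.
move=> fC; rewrite /edge_val; case: pickP => [[x y] /= /eqP E|/(_ (u, v))]; last first.
  by rewrite /= eqxx.
have := set21 x y; have := set22 x y; rewrite -E !in_set2.
have := set21 u v; have := set22 u v; rewrite E !in_set2.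
have := fC u v.
by move=> ? /orP[]/eqP ? /orP[]/eqP ? /orP[]/eqP ? /orP[]/eqP ?; congruence.
Qed.

Definition albertson (R : realType) (p : R) (G : sgraph) : R :=
  (\sum_(e in edges G)
     edge_val (fun u v : G => `|(deg u)%:R - (deg v)%:R| `^ p) e) `^ p^-1.

Definition zagreb (R : realType) (p : R) (H : sgraph) : R :=
  \sum_(v : H) (deg v)%:R `^ p.

(* Main.v *)
(* The edge [uv] of [G] is a vertex of degree [d(u) + d(v) - 2] in the line
   graph, and [|d(u) - d(v)| <= d(u) + d(v) - 2] with equality exactly when
   [u] or [v] is pendant.  Summing the [p]-th powers over the edges gives the
   bound, with equality iff every edge has a pendant endpoint; in a connected
   graph this makes a vertex of maximal degree the centre of a star. *)
Require Import Defs.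
From HB Require Import structures.
From mathcomp Require Import all_boot all_order all_algebra.
From mathcomp Require Import reals exp.
From mathcomp Require Import zify.

Set Implicit Arguments.
Unset Strict Implicit.
Unset Printing Implicit Defensive.

Import Order.TTheory GRing.Theory Num.Theory.
Local Open Scope ring_scope.

Lemma edgesP (G : sgraph) (e : {set G}) :
  reflect (exists u v : G, adj u v /\ e = [set u; v]) (e \in edges G).
Proof.
apply: (iffP imsetP) => [[[u v]]|[u [v [uv ->]]]].
  by rewrite inE /= => uv ->; exists u, v.
by exists (u, v); rewrite ?inE.
Qed.

Lemma adj_neq (G : sgraph) (u v : G) : adj u v -> u != v.
Proof. by apply: contraTneq => ->; rewrite adj_irr. Qed.

Lemma deg_gt0 (G : sgraph) (u v : G) : adj u v -> (0 < deg u)%N.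
Proof. by move=> uv; apply/card_gt0P; exists v; rewrite inE. Qed.

Lemma deg_gt1 (G : sgraph) (u v w : G) :
  adj u v -> adj u w -> v != w -> (1 < deg u)%N.
Proof.
by move=> uv uw vw; apply/card_gt1P; exists v, w; split; rewrite ?inE.
Qed.

Definition incident (G : sgraph) (u : G) : {set {set G}} :=
  [set e in edges G | u \in e].

Lemma incidentE (G : sgraph) (u : G) :
  incident u = [set [set u; w] | w in [set w | adj u w]].
Proof.
apply/setP=> e; rewrite inE; apply/andP/imsetP => [[/edgesP[x [y [xy ->]]]]|].
  rewrite in_set2 => /orP[]/eqP->; first by exists y; rewrite ?inE.
  by exists x; rewrite ?inE 1?adj_sym // setUC.
by case=> w; rewrite inE => uw ->; rewrite set21; split=> //; apply/edgesP; exists u, w.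
Qed.

(** The map sending a neighbour [w] to [[set u; w]] is injective, as there are no loops. *)
Lemma card_incident (G : sgraph) (u : G) : #|incident u| = deg u.
Proof.
rewrite incidentE card_in_imset // => v w; rewrite !inE => uv _ E.
have /set2P[vu|//] : v \in [set u; w] by rewrite -E set22.
by rewrite vu adj_irr in uv.
Qed.

Lemma incidentI (G : sgraph) (u v : G) :
  adj u v -> incident u :&: incident v = [set [set u; v]].
Proof.
move=> uv; apply/setP=> e; rewrite !inE; apply/idP/eqP => [|->]; last first.
  by rewrite set21 set22 !andbT andbb; apply/edgesP; exists u, v.
case/andP=> /andP[/edgesP[x [y [xy ->]]] ux] /andP[_ vx]; have := adj_neq uv.
by case/set2P: ux => ->; case/set2P: vx => ->; rewrite ?eqxx // setUC.
Qed.

(** The edges meeting [e], with [e] itself, form [incident u :|: incident v], and these two sets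
    share only [e]. Inclusion-exclusion counts [e] twice, hence the [.+2], which also avoids
    truncated subtraction. *)
Lemma deg_line_graph (G : sgraph) (e : line_graph G) (u v : G) :
  adj u v -> val e = [set u; v] -> (deg e).+2 = (deg u + deg v)%N.
Proof.
move=> uv Ee.
have -> : deg e = #|(incident u :|: incident v) :\ val e|.
  (* Neighbours of [e] live in a subtype; their images under [val] are sets of vertices of [G]. *)
  rewrite /deg -(card_imset _ val_inj); apply: eq_card => f.
  apply/imsetP/idP => [[g]|].
    rewrite inE /adj /= /line_adj => /andP[eg] /set0Pn[x].
    rewrite inE Ee in_set2 => /andP[+ xg] ->.
    have ge : val g != val e by rewrite (inj_eq val_inj) eq_sym.
    rewrite !inE ge (valP g) /=.
    by case/orP=> /eqP <-; rewrite xg ?orbT.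
  rewrite !inE => /andP[fe]; rewrite -andb_orr => /andP[fG uvf].
  exists (exist _ f fG) => //; rewrite inE /adj /= /line_adj -(inj_eq val_inj) /=.
  rewrite eq_sym fe; apply/set0Pn; case/orP: uvf => xf.
    by exists u; rewrite inE Ee set21.
  by exists v; rewrite inE Ee set22.
have eI : val e \in incident u :|: incident v.
  by rewrite !inE (valP e) Ee set21.
rewrite -!card_incident -cardsUI incidentI // cards1.
by rewrite (cardsD1 (val e) (_ :|: _)) eI addn1.
Qed.

Definition pendant_edge (G : sgraph) (e : {set G}) : bool :=
  [exists x in e, deg x == 1%N].

Lemma pendant_edge_set2 (G : sgraph) (u v : G) :
  pendant_edge [set u; v] = (deg u == 1)%N || (deg v == 1)%N.
Proof.
apply/existsP/orP => [[x /andP[/set2P[]->]]|[] d1]; first by left.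
- by right.
- by exists u; rewrite set21.
- by exists v; rewrite set22.
Qed.

Lemma leif_powR (R : realType) (p x y : R) (C : bool) : 0 < p ->
  0 <= x -> x <= y ?= iff C -> x `^ p <= y `^ p ?= iff C.
Proof.
move=> p0 x0 [xy <-]; have y0 := le_trans x0 xy.
split; first exact: ge0_ler_powR (ltW p0) _ _ _ _ _.
by apply/eqP/eqP => [|->//]; exact: (powR_injective p0).
Qed.

(** The gap between the two sides is [2 * (minn a b - 1)], which vanishes exactly when the smaller
    of [a] and [b] is 1. *)
Lemma leif_distn_deg (R : numDomainType) (a b d : nat) :
  (0 < a)%N -> (0 < b)%N -> d.+2 = (a + b)%N ->
  `|a%:R - b%:R| <= d%:R ?= iff (a == 1)%N || (b == 1)%N :> R.
Proof.
move=> a0 b0 E; rewrite -[a%:R]/(a%:~R) -[b%:R]/(b%:~R) -intrB -intr_norm.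
rewrite -abszE -[d%:R]/(d%:~R) leif_nat_r; split; last apply/eqP/orP; lia.
Qed.

Lemma leif_edge (R : realType) (G : sgraph) (p : R) (e : line_graph G) :
  0 < p ->
  edge_val (fun u v : G => `|(deg u)%:R - (deg v)%:R| `^ p) (val e)
    <= (deg e)%:R `^ p ?= iff pendant_edge (val e).
Proof.
move=> p0; have /edgesP[u [v [uv Ee]]] := valP e.
rewrite Ee edge_valE => [|x y]; last by rewrite distrC.
rewrite pendant_edge_set2; apply: leif_powR => //.
apply: leif_distn_deg; [exact: deg_gt0 uv | | exact: deg_line_graph].
by rewrite adj_sym in uv; exact: deg_gt0 uv.
Qed.

Lemma leif_albertson (R : realType) (G : sgraph) (p : R) : 0 < p ->
  albertson p G <= zagreb p (line_graph G) `^ p^-1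
    ?= iff [forall e : line_graph G, pendant_edge (val e)].
Proof.
(* Both sums now range over the vertices of the line graph and compare term by term. *)
move=> p0; rewrite /albertson /zagreb big_sub.
apply: leif_powR; first by rewrite invr_gt0.
  apply: sumr_ge0 => e _; rewrite /edge_val.
  by case: pickP => [uv _|//]; exact: powR_ge0.
by apply: leif_sum => e _; exact: leif_edge.
Qed.

(** The exclusive or says at once that [c] is joined to every other vertex and that no two other
    vertices are adjacent. *)
Definition star_center (G : sgraph) (c : G) : Prop :=
  forall u v : G, adj u v = (u == c) (+) (v == c).

Lemma star_center_pendant (G : sgraph) (c : G) (e : {set G}) :
  star_center c -> e \in edges G -> pendant_edge e.
Proof.
move=> cG /edgesP[u [v [uv ->]]]; rewrite pendant_edge_set2.
have leaf (x : G) : x != c -> deg x = 1%N.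
  move=> xc; rewrite /deg -(cards1 c); apply: eq_card => y.
  by rewrite !inE cG (negPf xc).
move: uv; rewrite cG; case: (eqVneq v c) => [_|/leaf->]; last by rewrite orbT.
by case: (eqVneq u c) => // /leaf->.
Qed.

Lemma pendant_star_center (G : sgraph) : graph_connected G ->
  (forall e : {set G}, e \in edges G -> pendant_edge e) -> exists c : G, star_center c.
Proof.
move=> [/card_gt0P[x0 _] connG] pend.
have pendE (u v : G) : adj u v -> (deg u == 1)%N || (deg v == 1)%N.
  by move=> uv; rewrite -pendant_edge_set2; apply: pend; apply/edgesP; exists u, v.
case: (@arg_maxnP G x0 predT (@deg G)) => // c _ cmax; exists c.
(* Otherwise [u] has degree at least 2, so the pendant end of the edge [cu] is [c], and
   [deg c = 1 < deg u] contradicts maximality. *)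
have no_detour (u v : G) : adj c u -> adj u v -> v = c.
  move=> cu uv; apply/eqP/negPn/negP => vc.
  have du : (1 < deg u)%N.
    by apply: (@deg_gt1 _ _ v c) => //; rewrite adj_sym.
  have := cmax u isT; have := pendE _ _ cu.
  by rewrite (gtn_eqF du) orbF => /eqP->; rewrite /= leqNgt du.
have dominated (v : G) : v != c -> adj c v.
  (* By [no_detour] the closed neighbourhood of [c] is closed under adjacency, so connectedness
     makes it the whole graph. *)
  pose A := [pred x : G | (x == c) || adj c x].
  have clA : closed (@adj G) A.
    apply: intro_closed => [|x y xy]; first exact/sym_connect_sym/adj_sym.
    rewrite !inE => /orP[/eqP <-|cx]; first by rewrite xy orbT.
    by rewrite (no_detour _ _ cx xy) eqxx.
  have := closed_connect clA (connG c v).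
  by rewrite !inE eqxx /= => /esym/orP[->|].
move=> u v; case: (eqVneq u c) => [->|uc]; case: (eqVneq v c) => [->|vc] /=.
- exact: adj_irr.
- exact: dominated.
- by rewrite adj_sym dominated.
(* An edge [uv] avoiding [c] would extend the edge [cu] to a forbidden detour. *)
- by apply/negP => /(no_detour _ _ (dominated _ uc)) /eqP; rewrite (negPf vc).
Qed.

Lemma star_isoP (G : sgraph) :
  (graph_iso G (complete_bipartite 1 #|G|.-1)) <->
  (exists c : G, star_center c).
Proof.
split=> [[f [g fK gK] fadj]|[c cG]].
  exists (g (inl ord0)) => u v; rewrite -fadj -!(can2_eq fK gK) /=.
  by case: (f u) (f v) => x [] y; rewrite ?ord1.
have cardC : #|[set~ c]| = #|G|.-1 by rewrite cardsC1.
(* The left point goes to the centre; the right points enumerate the complement of [c]. *)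
pose g (x : 'I_1 + 'I_(#|G|.-1)) : G :=
  if x is inr i then enum_val (cast_ord (esym cardC) i) else c.
have gc i : (g (inr i) == c) = false.
  by apply/negbTE; have := enum_valP (cast_ord (esym cardC) i); rewrite !inE.
have g_inj : injective g.
  move=> [i|i] [j|j]; first by rewrite !ord1.
  - by move/esym/eqP; rewrite gc.
  - by move/eqP; rewrite gc.
  - by move=> /enum_val_inj /cast_ord_inj ->.
(* Equal cardinalities make the injection [g] bijective; [c] shows that [#|G|] is positive, so its
   predecessor is not truncated. The isomorphism is the inverse [f]. *)
have [|f gK fK] := inj_card_bij g_inj.
  by rewrite card_sum !card_ord add1n prednK //; apply/card_gt0P; exists c.
exists f => [|u v]; first by exists g.
rewrite -[in RHS](fK u) -[in RHS](fK v) cG.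
by case: (f u) (f v) => x [] y; rewrite ?gc /= ?eqxx.
Qed.

Theorem theorem3p8 (R : realType) (G : sgraph) (n : nat) (p : R)
    (Gconn : graph_connected G) (cardG : #|G| = n) (p_gt0 : 0 < p) :
  albertson p G <= zagreb p (line_graph G) `^ p^-1 /\
  (albertson p G = zagreb p (line_graph G) `^ p^-1 <->
   graph_iso G (complete_bipartite 1 n.-1)).
Proof.
have [le_AZ eq_AZ] := leif_albertson G p_gt0; split=> //.
rewrite -cardG star_isoP; split=> [/eqP|[c cG]].
  rewrite eq_AZ => /forallP pend; apply: pendant_star_center => // e eG.
  exact: (pend (exist _ e eG)).
apply/eqP; rewrite eq_AZ; apply/forallP => e.
exact: star_center_pendant cG (valP e).
Qed.
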